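(* Let $\Phi=\{\varphi_i\}_{i=1}^M$ be a unit norm frame for $\mathbb{R}^N$. Then $\Phi$ is scalable if and only if its minimal ellipsoid $E_\Phi$ is the $N$-dimensional (closed, origin-centered) Euclidean unit ball, in which case $V_\Phi=1$.
   Context: A sequence $\Phi=\{\varphi_i\}_{i=1}^M\subset\mathbb{R}^N$ is a frame if there are $0<A\le B<\infty$ with $A\|x\|^2\le\sum_{i=1}^M|\langle x,\varphi_i\rangle|^2\le B\|x\|^2$ for all $x\in\mathbb{R}^N$; it is tight if one may take $A=B$; it is unit norm if $\|\varphi_i\|_2=1$ for all $i$. A frame $\Phi$ is scalable if there exist nonnegative scalars $s_1,\dots,s_M$ such that $\{s_i\varphi_i\}_{i=1}^M$ is a tight frame for $\mathbb{R}^N$. For a positive definite $N\times N$ matrix $X$ and $c\in\mathbb{R}^N$, $E(X,c)=\{v\in\mathbb{R}^N:\langle X(v-c),v-c\rangle\le 1\}$ is an ellipsoid with center $c$. The minimal ellipsoid $E_\Phi$ of $\Phi$ is the unique ellipsoid of minimal volume containing the convex hull of $\{\varphi_i\}_{i=1}^M\cup\{-\varphi_i\}_{i=1}^M$. Finally $V_\Phi=\mathrm{Vol}(E_\Phi)/\omega_N$, where $\omega_N$ is the volume of the unit ball in $\mathbb{R}^N$. *)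

(* Defs.v *)
From HB Require Import structures.
From mathcomp Require Import all_boot all_order all_algebra.
From mathcomp Require Import all_classical all_reals all_analysis.

Set Implicit Arguments.
Unset Strict Implicit.
Unset Printing Implicit Defensive.

Import Order.TTheory GRing.Theory Num.Theory.

Local Open Scope classical_set_scope.
Local Open Scope ring_scope.

Section Euclidean.
Context {R : realType}.

Definition dot N (x y : 'cV[R]_N) : R := \sum_(i < N) x i ord0 * y i ord0.

(* The norm `|x| that the library puts on matrices is the sup norm. *)
Definition enorm N (x : 'cV[R]_N) : R := Num.sqrt (dot x x).

(* N-dimensional Lebesgue measure, as the N-fold product of the library's
   Lebesgue measure on R: the successor case is the library's product measure
   (integral of the measure of the sections), with R * R^n identified with
   R^n.+1.  Only its values on Borel sets, such as ellipsoids, are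
   meaningful. *)
Fixpoint vol N : set 'cV[R]_N -> \bar R :=
  match N with
  | 0 => fun A => ((\1_A 0)%:E)
  | n.+1 => fun A : set 'cV[R]_(1 + n) =>
      (\int[lebesgue_measure]_x
         vol [set v : 'cV[R]_n | A (col_mx (x%:M : 'cV[R]_1) v)])%E
  end.

Definition convex_hull N (A : set 'cV[R]_N) : set 'cV[R]_N :=
  smallest (@convex_set R 'cV[R]_N) A.

Definition posdef N (X : 'M[R]_N) : Prop :=
  X^T = X /\ forall v : 'cV[R]_N, v != 0 -> 0 < dot (X *m v) v.

Definition ellipsoid N (X : 'M[R]_N) (c : 'cV[R]_N) : set 'cV[R]_N :=
  [set v | dot (X *m (v - c)) (v - c) <= 1].

Definition is_ellipsoid N (E : set 'cV[R]_N) : Prop :=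
  exists X c, posdef X /\ E = ellipsoid X c.

Definition unit_ball N : set 'cV[R]_N := [set v | enorm v <= 1].

End Euclidean.

Section Frames.
Context {R : realType} {M N : nat}.
Implicit Type phi : 'I_M -> 'cV[R]_N.

Definition frame_bounds phi (A B : R) : Prop :=
  0 < A /\ A <= B /\
  forall x : 'cV[R]_N,
    A * enorm x ^+ 2 <= \sum_(i < M) `|dot x (phi i)| ^+ 2 /\
    \sum_(i < M) `|dot x (phi i)| ^+ 2 <= B * enorm x ^+ 2.

Definition is_frame phi : Prop := exists A B, frame_bounds phi A B.

Definition tight_frame phi : Prop := exists A, frame_bounds phi A A.

Definition unit_norm phi : Prop := forall i, enorm (phi i) = 1.

Definition scalable_frame phi : Prop :=
  exists s : 'I_M -> R,
    (forall i, 0 <= s i) /\ tight_frame (fun i => s i *: phi i).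

Definition sym_hull phi : set 'cV[R]_N :=
  convex_hull (range phi `|` range (fun i => - phi i)).

Definition is_min_ellipsoid phi (E : set 'cV[R]_N) : Prop :=
  [/\ is_ellipsoid E, sym_hull phi `<=` E &
      forall E', is_ellipsoid E' -> sym_hull phi `<=` E' ->
        (vol E <= vol E')%E].

(* For a frame, exactly one ellipsoid satisfies is_min_ellipsoid, and xget
   selects it; set0 is only the default value of xget. *)
Definition min_ellipsoid phi : set 'cV[R]_N :=
  xget set0 [set E | is_min_ellipsoid phi E].

Definition rel_vol phi : R :=
  fine (vol (min_ellipsoid phi)) / fine (vol (@unit_ball R N)).

End Frames.

(* Main.v *)
Require Import Defs.
From mathcomp Require Import all_boot all_order all_algebra.
From mathcomp Require Import all_classical all_reals all_analysis.
From mathcomp Require Import measurable_realfun ring lra.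

(** Write [frame_op phi w] for the matrix [sum_i w_i phi_i phi_i^T].  After
    normalizing the tight bound to 1, scalability of [phi] says exactly that
    the identity matrix is [frame_op phi w] for some nonnegative weights [w]
    ([scalable_frameP]).

    The volume of the ellipsoid of [X] is [kappa_N / sqrt (det X)]
    ([vol_ellipsoid]), so a smallest ellipsoid is one with the largest
    determinant.  Ellipsoids are convex, so containing the symmetric hull only
    means containing each [phi_i] and [- phi_i].

    If the identity is [frame_op phi w], then the weights add up to [N], and
    averaging over [w] the inequalities that say that [phi_i] and [- phi_i] are
    in the ellipsoid of [X] and [c] gives [tr X + N <X c, c> <= N].  Together
    with [det X <= exp (tr X - N)] ([posdef_det_le_expR], a form of the
    inequality between arithmetic and geometric means) this yields
    [det X <= 1], the value for the unit ball.  If [det X >= 1], then equality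
    holds everywhere, which forces [X = 1] ([posdef_det_ge1_tr_le]) and
    [c = 0].  So the ball is the unique minimal ellipsoid.

    If the identity is not in the cone spanned by the [phi_i phi_i^T], Farkas'
    lemma ([farkas]) separates it from that cone: there is a symmetric matrix
    [S] with [tr S > 0] and [<S phi_i, phi_i> <= 0] for all [i].  For small
    [e > 0] the ellipsoid of [1 + e S] still contains all [phi_i] and
    [- phi_i], while [det (1 + e S) = 1 + e tr S + O(e^2) > 1]
    ([posdef_perturbation]): it is strictly smaller than the ball, which is
    therefore not minimal.

    Both the determinant inequality and the volume formula go by induction on
    the dimension, completing the square in the first coordinate
    ([posdef_schur]); this is the coordinate along which [vol] slices. *)

Set Implicit Arguments.
Unset Strict Implicit.
Unset Printing Implicit Defensive.

Import Order.TTheory GRing.Theory Num.Theory.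

Local Open Scope classical_set_scope.
Local Open Scope ring_scope.

(** * Quadratic forms and positive definite matrices *)

Section QuadraticForms.
Context {R : realType}.

Definition qform N (X : 'M[R]_N) (v : 'cV[R]_N) : R := dot (X *m v) v.

Lemma dotE N (x y : 'cV[R]_N) : dot x y = (y^T *m x) ord0 ord0.
Proof. by rewrite mxE; apply: eq_bigr => i _; rewrite mxE mulrC. Qed.

Lemma dot_mxtrace N (x y : 'cV[R]_N) : dot x y = \tr (x *m y^T).
Proof. by rewrite mxtrace_mulC dotE /mxtrace big_ord1. Qed.

Lemma dotC N (x y : 'cV[R]_N) : dot x y = dot y x.
Proof. by apply: eq_bigr => i _; rewrite mulrC. Qed.

Lemma dotDl N (x y z : 'cV[R]_N) : dot (x + y) z = dot x z + dot y z.
Proof. by rewrite !dotE mulmxDr mxE. Qed.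

Lemma dotZl N a (x y : 'cV[R]_N) : dot (a *: x) y = a * dot x y.
Proof. by rewrite !dotE -scalemxAr mxE. Qed.

Lemma dotDr N (x y z : 'cV[R]_N) : dot z (x + y) = dot z x + dot z y.
Proof. by rewrite !(dotC z) dotDl. Qed.

Lemma dotZr N a (x y : 'cV[R]_N) : dot y (a *: x) = a * dot y x.
Proof. by rewrite !(dotC y) dotZl. Qed.

Lemma dotNl N (x y : 'cV[R]_N) : dot (- x) y = - dot x y.
Proof. by rewrite -scaleN1r dotZl mulN1r. Qed.

Lemma dotNr N (x y : 'cV[R]_N) : dot x (- y) = - dot x y.
Proof. by rewrite dotC dotNl dotC. Qed.

Lemma dotr0 N (x : 'cV[R]_N) : dot x 0 = 0.
Proof. by rewrite dotE trmx0 mul0mx mxE. Qed.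

Lemma dot_mulmx N (X : 'M[R]_N) (x y : 'cV[R]_N) :
  dot (X *m x) y = dot x (X^T *m y).
Proof. by rewrite !dotE trmx_mul trmxK mulmxA. Qed.

Lemma dot_ge0 N (x : 'cV[R]_N) : 0 <= dot x x.
Proof. by apply: sumr_ge0 => i _; rewrite -expr2 sqr_ge0. Qed.

Lemma dot_eq0 N (x : 'cV[R]_N) : dot x x = 0 -> x = 0.
Proof.
move=> /eqP; rewrite psumr_eq0 => [/allP h|i _]; last by rewrite -expr2 sqr_ge0.
apply/colP => i; have := h i (mem_index_enum i).
by rewrite /= mulf_eq0 orbb mxE => /eqP.
Qed.

Lemma enorm_sqr N (x : 'cV[R]_N) : enorm x ^+ 2 = dot x x.
Proof. by rewrite sqr_sqrtr ?dot_ge0. Qed.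

Lemma dot_col_mx m n (a c : 'cV[R]_m) (b d : 'cV[R]_n) :
  dot (col_mx a b) (col_mx c d) = dot a c + dot b d.
Proof. by rewrite !dotE tr_col_mx mul_row_col mxE. Qed.

Lemma qform1 N (v : 'cV[R]_N) : qform 1%:M v = dot v v.
Proof. by rewrite /qform mul1mx. Qed.

Lemma qformDl N (X Y : 'M[R]_N) v : qform (X + Y) v = qform X v + qform Y v.
Proof. by rewrite /qform mulmxDl dotDl. Qed.

Lemma qformZl N a (X : 'M[R]_N) v : qform (a *: X) v = a * qform X v.
Proof. by rewrite /qform -scalemxAl dotZl. Qed.

Lemma qformZ N a (X : 'M[R]_N) v : qform X (a *: v) = a ^+ 2 * qform X v.
Proof. by rewrite /qform -scalemxAr dotZl dotZr mulrA. Qed.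

Lemma qformN N (X : 'M[R]_N) v : qform X (- v) = qform X v.
Proof. by rewrite -scaleN1r qformZ expr2 mulrNN !mul1r. Qed.

Lemma qform_tr N (X : 'M[R]_N) v : qform X^T v = qform X v.
Proof. by rewrite /qform dot_mulmx trmxK dotC. Qed.

Lemma qform_mxtrace N (X : 'M[R]_N) v : qform X v = \tr (X *m (v *m v^T)).
Proof. by rewrite /qform dot_mxtrace mulmxA. Qed.

Lemma qformD N (X : 'M[R]_N) x y : X^T = X ->
  qform X (x + y) = qform X x + 2 * dot (X *m x) y + qform X y.
Proof.
move=> sX; rewrite /qform mulmxDr !dotDl !dotDr (dot_mulmx X y x) sX.
by rewrite (dotC y); ring.
Qed.

Lemma qform_parallelogram N (X : 'M[R]_N) x y : X^T = X ->
  qform X (x - y) + qform X (x + y) = 2 * (qform X x + qform X y).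
Proof. by move=> sX; rewrite !qformD// qformN dotNr; ring. Qed.

Lemma qform0 N (X : 'M[R]_N) : qform X 0 = 0.
Proof. by rewrite -(scale0r 0) qformZ expr0n mul0r. Qed.

(** Polarization: evaluating the form at [x + X x] isolates [<X x, X x>]. *)
Lemma qform_eq0 N (X : 'M[R]_N) : X^T = X -> (forall v, qform X v = 0) -> X = 0.
Proof.
move=> sX X0; apply/trmx_inj/row_matrixP => i.
have h : X *m delta_mx i ord0 = 0 :> 'cV_N.
  apply: dot_eq0; set x := delta_mx _ _.
  have := X0 (x + X *m x); rewrite qformD// !X0 => /eqP.
  by rewrite add0r addr0 mulf_eq0 pnatr_eq0 => /eqP.
by rewrite trmx0 row0 -tr_col colE h trmx0.
Qed.

Lemma posdef_ge0 N (X : 'M[R]_N) v : posdef X -> 0 <= qform X v.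
Proof.
by move=> [_ pX]; have [->|/pX/ltW//] := eqVneq v 0; rewrite qform0.
Qed.

Lemma posdef_eq0 N (X : 'M[R]_N) v : posdef X -> qform X v = 0 -> v = 0.
Proof.
move=> [_ pX] X0; apply/eqP/negPn/negP => /pX.
by rewrite -/(qform X v) X0 ltxx.
Qed.

Lemma posdef1 N : posdef (1%:M : 'M[R]_N).
Proof.
split=> [|v v0]; first exact: trmx1.
rewrite mul1mx lt_def dot_ge0 andbT; apply: contra_neq v0; exact: dot_eq0.
Qed.

Lemma posdef_unitmx N (X : 'M[R]_N) : posdef X -> X \in unitmx.
Proof.
move=> pX; rewrite -row_free_unit -kermx_eq0.
apply/eqP/row_matrixP => i; rewrite row0.
set x := row i _; have xX : x *m X = 0 by apply/sub_kermxP; exact: row_sub.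
apply: trmx_inj; rewrite trmx0; apply: (posdef_eq0 pX).
by rewrite /qform -{1}pX.1 -trmx_mul xX trmx0 dotE mulmx0 mxE.
Qed.

(** The matrix [U^T diag(s, D) U] with [U] unipotent and first column
    [(1, u)]: one step of the [L D L^T] decomposition.  As a quadratic form it
    is [s t^2 + D(w + t u)], see [schur_mx_qform]. *)
Definition schur_mx n (s : R) (u : 'cV[R]_n) (D : 'M[R]_n) : 'M[R]_(1 + n) :=
  block_mx (s%:M + u^T *m D *m u) (u^T *m D) (D *m u) D.

Lemma schur_mx_qform n s (u : 'cV[R]_n) D (t : R) w : D^T = D ->
  qform (schur_mx s u D) (col_mx t%:M w) = s * t ^+ 2 + qform D (w + t *: u).
Proof.
move=> sD.
rewrite /qform /schur_mx mul_block_col dot_col_mx !mul_mx_scalar.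
have -> : D *m (w + t *: u) = D *m w + t *: (D *m u).
  by rewrite mulmxDr -scalemxAr.
rewrite !scalerDr !dotDl !dotDr !dotZl !dotZr.
have dot11 (x : 'M[R]_1) : dot x t%:M = x ord0 ord0 * t.
  by rewrite /dot big_ord1 !mxE eqxx mulr1n.
rewrite !dot11 [s%:M _ _]mxE eqxx mulr1n -!mulmxA -!dotE.
by ring.
Qed.

Lemma schur_mx_det n s (u : 'cV[R]_n) D :
  \det (schur_mx s u D) = s * \det D.
Proof.
have -> : schur_mx s u D =
    block_mx 1%:M u^T 0 1%:M *m block_mx s%:M 0 0 D *m block_mx 1%:M 0 u 1%:M.
  by rewrite !mulmx_block !mul1mx !mul0mx !mulmx1 !mulmx0 !add0r !addr0.
by rewrite !det_mulmx !det_ublock det_lblock !det1 det_scalar1 !mul1r !mulr1.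
Qed.

Lemma schur_mx_tr n s (u : 'cV[R]_n) D :
  \tr (schur_mx s u D) = s + qform D u + \tr D.
Proof.
rewrite mxtrace_block linearD /= mxtrace_scalar mulr1n.
by rewrite /qform dot_mxtrace [in RHS]mxtrace_mulC mulmxA.
Qed.

(** Completing the square in the first coordinate: [D] is the lower right
    block, [u] is [D^-1] times the rest of the first column, and [s] is the
    Schur complement, which is positive as the value of the form at
    [(1, - u)]. *)
Lemma posdef_schur n (X : 'M[R]_(1 + n)) : posdef X ->
  exists s u D, [/\ 0 < s, posdef D & X = schur_mx s u D].
Proof.
move=> pX; pose D := drsubmx X; pose u := invmx D *m dlsubmx X.
have sX := pX.1; have sD : D^T = D by rewrite /D trmx_drsub sX.
have qD v : qform D v = qform X (col_mx 0 v).
  rewrite -[in RHS](submxK X) /qform mul_block_col !mulmx0 !add0r dot_col_mx.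
  by rewrite dotr0 add0r.
have pD : posdef D.
  split=> // v v0; rewrite -/(qform D v) qD; apply: pX.2.
  by apply: contra_neq v0 => /(congr1 dsubmx); rewrite col_mxKd linear0.
have DU := posdef_unitmx pD.
pose s := ulsubmx X ord0 ord0 - qform D u.
have XE : X = schur_mx s u D.
  rewrite -[X]submxK /schur_mx -/D.
  have Du : D *m u = dlsubmx X by rewrite mulKVmx.
  have -> : u^T *m D = ursubmx X.
    by rewrite -{1}sD -trmx_mul Du trmx_dlsub sX.
  rewrite Du; congr block_mx; apply/matrixP => i j.
  have uu : (ursubmx X *m u) ord0 ord0 = qform D u.
    by rewrite /qform Du dotC dotE trmx_dlsub sX.
  by rewrite !ord1 [RHS]mxE uu [X in X + _]mxE eqxx mulr1n subrK.
exists s, u, D; split=> //.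
have := schur_mx_qform s u 1 (- u) sD; rewrite -XE expr1n mulr1 scale1r addNr.
rewrite qform0 addr0 => <-; apply: pX.2.
apply/eqP => /(congr1 usubmx); rewrite col_mxKu linear0 => /matrixP/(_ 0 0).
by rewrite !mxE eqxx => /eqP; rewrite oner_eq0.
Qed.

Lemma posdef_det_gt0 N (X : 'M[R]_N) : posdef X -> 0 < \det X.
Proof.
elim: N X => [X _|n IH X]; first by rewrite det_mx00 ltr01.
move=> /(@posdef_schur n)[s [u [D [s0 pD ->]]]].
by rewrite schur_mx_det mulr_gt0// IH.
Qed.

(** In diagonal form this is the product over the diagonal entries [s] of
    [s <= exp (s - 1)]; the term [qform D u] of the trace that is not one of
    these entries is nonnegative. *)
Lemma posdef_det_le_expR N (X : 'M[R]_N) : posdef X ->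
  \det X <= expR (\tr X - N%:R).
Proof.
elim: N X => [X _|n IH X].
  by rewrite det_mx00 flatmx0 mxtrace0 subr0 expR0.
move=> /(@posdef_schur n)[s [u [D [s0 pD ->]]]].
rewrite schur_mx_det schur_mx_tr.
have -> : s + qform D u + \tr D - n.+1%:R =
    (s - 1) + (qform D u + (\tr D - n%:R)) by rewrite -natr1; ring.
rewrite expRD; apply: ler_pM; [exact: ltW | exact/ltW/posdef_det_gt0 | |].
  by have := expR_ge1Dx (s - 1); rewrite addrC subrK.
by rewrite (le_trans (IH _ pD))// ler_expR lerDr posdef_ge0.
Qed.

(** The equality case of [posdef_det_le_expR].  At each step of the
    decomposition both [s = exp (s - 1)], hence [s = 1], and [qform D u = 0],
    hence [u = 0]. *)
Lemma posdef_det_ge1_tr_le N (X : 'M[R]_N) : posdef X ->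
  1 <= \det X -> \tr X <= N%:R -> X = 1%:M.
Proof.
elim: N X => [X _ _ _|n IH X]; first by rewrite !flatmx0.
move=> /(@posdef_schur n)[s [u [D [s0 pD ->]]]].
rewrite schur_mx_det schur_mx_tr -natr1 => det1 tr1.
have D0 := posdef_det_gt0 pD; have u0 := posdef_ge0 u pD.
have Dle := posdef_det_le_expR pD.
(* exp (1 - s) <= 1 / s <= det D <= exp (tr D - n), while the trace bound
   says tr D - n <= 1 - s. *)
have h : s^-1 <= expR (\tr D - n%:R).
  by apply: le_trans Dle; rewrite -[s^-1]mulr1 ler_pdivrMl.
have hs : expR (1 - s) <= s^-1.
  rewrite -opprB expRN lef_pV2 ?posrE ?expR_gt0//.
  by have := expR_ge1Dx (s - 1); rewrite addrC subrK.
have hD : 1 - s <= \tr D - n%:R by rewrite -ler_expR (le_trans hs).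
have Eu : qform D u = 0 by lra.
have Etr : \tr D - n%:R = 1 - s by lra.
have /eqP Es : s == 1.
  apply/negPn/negP; rewrite -subr_eq0 => /expR_gt1Dx.
  rewrite addrC subrK ltNge => /negP; apply.
  move: h; rewrite Etr -(opprB s 1) expRN lef_pV2 ?posrE ?expR_gt0//.
have -> : u = 0 by exact: posdef_eq0 Eu.
have -> : D = 1%:M.
  by apply: IH => //; [move: det1; rewrite Es mul1r | lra].
by rewrite /schur_mx Es trmx0 !mul0mx !mulmx0 addr0 -scalar_mx_block.
Qed.
End QuadraticForms.

(** * One-dimensional integrals of ball sections *)

Section Volume.
Context {R : realType}.
Notation mu := (@lebesgue_measure R).

(** The pushforward of the Lebesgue measure by [x |-> a (x - c)], multiplied by
    [a], gives each interval its length, so it is the Lebesgue measure.  This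
    covers the discontinuous integrand [ball_section 0]. *)
Lemma ge0_integral_affine (a c : R) (G : R -> \bar R) : 0 < a ->
  measurable_fun [set: R] G -> (forall x, (0 <= G x)%E) ->
  (\int[mu]_x G x = a%:E * \int[mu]_x G (a * (x - c))%R)%E.
Proof.
move=> a0 mG G0.
pose f : measurableTypeR R -> measurableTypeR R := fun x => a * (x - c).
have mf : measurable_fun [set: measurableTypeR R] f.
  by apply: measurable_funM => //; exact: measurable_funB.
pose a' : {nonneg R} := NngNum (ltW a0).
pose nu : {measure set (measurableTypeR R) -> \bar R} :=
  mscale a' (pushforward mu f).
rewrite (eq_measure_integral (nu mf)); last first.
  move=> A mA _; apply: lebesgue_measure_unique => // X [[p q] _ <-] /=.
  change (mu `]p, q] = a%:E * mu (f @^-1` `]p, q]))%E.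
  have -> : f @^-1` `]p, q] = `]c + p / a, c + q / a]%classic.
    apply/seteqP; split=> x /=; rewrite !in_itv/= /f.
      by rewrite -ltrBDl ltr_pdivrMr// -lerBDl ler_pdivlMr// ![_ * a]mulrC.
    by rewrite -ltrBDl ltr_pdivrMr// -lerBDl ler_pdivlMr// ![_ * a]mulrC.
  rewrite !lebesgue_measure_itv/= !lte_fin ltrD2l ltr_pM2r ?invr_gt0//.
  case: ifP => _; last by rewrite mule0.
  by rewrite -!EFinB -EFinM; congr EFin; field; rewrite gt_eqF.
rewrite ge0_integral_mscale// ge0_integral_pushforward//.
Qed.

(** The volume of the [n]-ball of squared radius [r], up to the factor
    [ball_volume n].  For [n = 0] the value at [r = 0] is 1, the volume of a
    point, and the test [0 <= r] makes the ball empty when [r < 0]. *)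
Definition ball_section n (r : R) : R :=
  if 0 <= r then Num.sqrt r ^+ n else 0.

Lemma ball_section_ge0 n r : 0 <= ball_section n r.
Proof. by rewrite /ball_section; case: ifP => // _; rewrite exprn_ge0. Qed.

Lemma ball_sectionM n (r x : R) : 0 < r ->
  ball_section n (r * x) = Num.sqrt r ^+ n * ball_section n x.
Proof.
move=> r0; rewrite /ball_section pmulr_rge0//; case: ifP => x0.
  by rewrite sqrtrM ?ltW// exprMn.
by rewrite mulr0.
Qed.

Lemma measurable_ball_section n (f : R -> R) : measurable_fun [set: R] f ->
  measurable_fun [set: R] (fun x => ball_section n (f x)).
Proof.
move=> mf; apply: measurable_fun_ifT => //.
  by apply: measurable_fun_ler.
apply: measurable_funX; apply: measurableT_comp => //.
by apply: continuous_measurable_fun; exact: sqrt_continuous.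
Qed.

(** The ratio of the volumes of the unit balls of dimensions [n.+1] and [n]. *)
Definition chord_integral n : \bar R :=
  (\int[mu]_x (ball_section n (1 - x ^+ 2))%:E)%E.

Lemma measurable_chord n (r s c : R) :
  measurable_fun [set: R] (fun x => (ball_section n (r - s * (x - c) ^+ 2))%:E).
Proof.
apply/measurable_EFinP; apply: measurable_ball_section.
apply: measurable_funB => //; apply: measurable_funM => //.
by apply: measurable_funX; exact: measurable_funB.
Qed.

Lemma measurable_unit_chord n :
  measurable_fun [set: R] (fun x : R => (ball_section n (1 - x ^+ 2))%:E).
Proof.
have := measurable_chord n 1 1 0.
by under eq_fun do rewrite subr0 mul1r.
Qed.

Lemma chord_integral_lty n : (chord_integral n < +oo)%E.
Proof.
have mI : measurable (`[(-1), 1]%classic : set R) by exact: measurable_itv.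
apply: (@le_lt_trans _ _ (\int[mu]_x (\1_(`[(-1), 1] : set R) x)%:E)%E).
  apply: ge0_le_integral => //.
  - by move=> x _; rewrite lee_fin ball_section_ge0.
  - exact: measurable_unit_chord.
  - by apply/measurable_EFinP; exact: measurable_indic.
  move=> x _; rewrite lee_fin /ball_section subr_ge0.
  case: ifPn => // x1; rewrite indicE mem_set /=.
    apply: exprn_ile1 => //; rewrite -[leRHS]sqrtr1 ler_wsqrtr//.
    by rewrite lerBlDr lerDl sqr_ge0.
  by rewrite in_itv/=; apply/andP; split; nra.
rewrite integral_indic// setIT /= lebesgue_measure_itv/= lte_fin.
by case: ifP => // _; rewrite -EFinB ltry.
Qed.

Lemma chord_integral_gt0 n : (0 < chord_integral n)%E.
Proof.
have mI : measurable (`[0, 2^-1]%classic : set R) by exact: measurable_itv.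
(* On [0, 1/2] the integrand is at least sqrt (1/2) ^ n. *)
pose k : R := Num.sqrt 2^-1 ^+ n.
have k0 : 0 < k by rewrite exprn_gt0// sqrtr_gt0 invr_gt0.
apply: (@lt_le_trans _ _ (\int[mu]_(x in `[0%R, 2^-1%R]) (cst k%:E) x)%E).
  rewrite integral_cst//= lebesgue_measure_itv/= lte_fin invr_gt0 ltr0n.
  by rewrite -EFinB -EFinM lte_fin mulr_gt0// subr0 invr_gt0.
have mf := measurable_unit_chord n.
apply: (@le_trans _ _ (\int[mu]_(x in `[0%R, 2^-1%R])
  (ball_section n (1 - x ^+ 2))%:E)%E).
  apply: ge0_le_integral => //=.
  - by move=> x _; rewrite lee_fin ltW.
  - exact: measurable_funTS.
  - move=> x; rewrite in_itv/= => /andP[x0 x1].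
    have h : 2^-1 <= 1 - x ^+ 2.
      by nra.
    rewrite lee_fin /ball_section (le_trans _ h) ?invr_ge0//.
    by rewrite lerXn2r ?nnegrE// ler_wsqrtr.
apply: ge0_subset_integral => // x _.
by rewrite lee_fin ball_section_ge0.
Qed.

Fixpoint ball_volume n : R :=
  if n is n'.+1 then ball_volume n' * fine (chord_integral n') else 1.

Lemma chord_integralE n : chord_integral n = (fine (chord_integral n))%:E.
Proof.
rewrite fineK// ge0_fin_numE ?chord_integral_lty//.
exact/ltW/chord_integral_gt0.
Qed.

Lemma ball_volume_gt0 n : 0 < ball_volume n.
Proof.
elim: n => //= n IH; rewrite mulr_gt0//.
by rewrite -lte_fin -chord_integralE chord_integral_gt0.
Qed.

(** Homogeneity: for [r > 0] the substitution [y = sqrt (s / r) (x - c)]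
    reduces to [chord_integral n]; for [r < 0] the integrand vanishes; for
    [r = 0] it is supported on the null set [{c}] (on which it is 1 if
    [n = 0]). *)
Lemma integral_ball_section n (r s c : R) : 0 < s ->
  (\int[mu]_x (ball_section n (r - s * (x - c) ^+ 2))%:E)%E =
  (ball_section n.+1 r * fine (chord_integral n) / Num.sqrt s)%:E.
Proof.
move=> s0; case: (ltrgtP 0 r) => [r0|r0|<-].
- pose a := Num.sqrt s / Num.sqrt r.
  have a0 : 0 < a by rewrite divr_gt0// sqrtr_gt0.
  have e x : ball_section n (r - s * (x - c) ^+ 2) =
      Num.sqrt r ^+ n * ball_section n (1 - (a * (x - c)) ^+ 2).
    rewrite -ball_sectionM//; congr ball_section.
    rewrite mulrBr mulr1 exprMn exprMn exprVn !sqr_sqrtr ?ltW//.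
    by field; rewrite gt_eqF.
  have f0 x : (0 <= (ball_section n (1 - x ^+ 2))%:E :> \bar R)%E.
    by rewrite lee_fin ball_section_ge0.
  under eq_integral do rewrite e EFinM.
  rewrite ge0_integralZl_EFin//; last first.
    apply/measurable_EFinP; apply: measurable_ball_section.
    apply: measurable_funB => //.
    apply: measurable_funX; apply: measurable_funM => //.
    exact: measurable_funB.
  have := ge0_integral_affine c a0 (@measurable_unit_chord n) f0.
  rewrite -/(chord_integral n) chord_integralE => h.
  set I := (\int[mu]_x _)%E in h *.
  have -> : I = (a^-1 * fine (chord_integral n))%:E.
    by rewrite EFinM h muleA -EFinM mulVf ?mul1e ?gt_eqF.
  rewrite -EFinM /ball_section ltW//; congr EFin.
  by rewrite /a exprSr; field; rewrite !gt_eqF ?sqrtr_gt0.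
- rewrite integral0_eq => [|x _].
    by rewrite /ball_section leNgt r0 !mul0r.
  rewrite /ball_section subr_ge0 leNgt (lt_le_trans r0)//.
  by rewrite mulr_ge0 ?sqr_ge0// ltW.
- have -> : ball_section n.+1 0 = 0 :> R.
    by rewrite /ball_section lexx sqrtr0 expr0n.
  rewrite !mul0r.
  pose f (x : R) := (ball_section n (0 - s * (x - c) ^+ 2))%:E.
  apply: etrans (integral_set1 f c).
  rewrite [RHS]integral_mkcond; apply: eq_integral => x _.
  rewrite patchE; case: ifPn => // xA.
  have xc : x != c by apply: contra xA => /eqP ->; exact/mem_set.
  rewrite /ball_section sub0r oppr_ge0 leNgt mulr_gt0// exprn_even_gt0//=.
  by rewrite subr_eq0 xc.
Qed.
End Volume.

(** * Volume and convexity of ellipsoids *)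

Section EllipsoidVolume.
Context {R : realType}.

(** Right-hand sides [r] other than 1 are needed for the induction: by
    [posdef_schur], the section of an ellipsoid at first coordinate [x] is an
    ellipsoid with matrix [D], a shifted center, and [r - s (x - c0)^2] in
    place of [r]. *)
Lemma vol_qform N (X : 'M[R]_N) c (r : R) : posdef X ->
  vol [set v | qform X (v - c) <= r] =
  (ball_volume N * ball_section N r / Num.sqrt (\det X))%:E.
Proof.
elim: N X c r => [|n IH] X c r.
  move=> _; rewrite /= indicE det_mx00 sqrtr1 divr1 mul1r /ball_section expr0.
  have -> : (0 \in [set v | qform X (v - c) <= r]) = (0 <= r).
    by rewrite /in_mem /= /in_set asboolb /qform /dot big_ord0.
  by case: ifP.
move=> /(@posdef_schur _ n)[s [u [D [s0 pD ->]]]].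
pose c0 := usubmx (c : 'cV_(1 + n)) ord0 ord0.
pose c1 := dsubmx (c : 'cV_(1 + n)).
have cE : c = col_mx c0%:M c1.
  by rewrite -[LHS](@vsubmxK _ 1 n) [X in col_mx X _]mx11_scalar.
have section x :
    [set v : 'cV_n |
      qform (schur_mx s u D) (col_mx (x%:M : 'cV_1) v - c) <= r] =
    [set v | qform D (v - (c1 - (x - c0) *: u)) <= r - s * (x - c0) ^+ 2].
  apply/funext => v /=; congr (is_true _).
  have -> : col_mx (x%:M : 'cV_1) v - c = col_mx (x - c0)%:M (v - c1).
    rewrite {1}cE -[LHS]/(col_mx x%:M v - col_mx c0%:M c1 : 'cV_(1 + n)).
    by rewrite opp_col_mx add_col_mx raddfB.
  by rewrite schur_mx_qform ?pD.1// lerBrDl opprB addrA addrAC.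
rewrite /=; under eq_integral do rewrite section IH// mulrAC EFinM.
rewrite ge0_integralZl_EFin//; last 3 first.
- by move=> x _; rewrite lee_fin ball_section_ge0.
- exact: measurable_chord.
- by rewrite divr_ge0// ltW// ball_volume_gt0.
rewrite integral_ball_section// schur_mx_det sqrtrM ?ltW//.
rewrite -EFinM; congr EFin; field.
by rewrite !gt_eqF// sqrtr_gt0// posdef_det_gt0.
Qed.

Lemma vol_ellipsoid N (X : 'M[R]_N) c : posdef X ->
  vol (ellipsoid X c) = (ball_volume N / Num.sqrt (\det X))%:E.
Proof.
move=> pX; have := vol_qform c 1 pX.
by rewrite /ball_section ler01 sqrtr1 expr1n mulr1.
Qed.

Lemma vol_ellipsoid_le N (X Y : 'M[R]_N) c d : posdef X -> posdef Y ->
  (vol (ellipsoid X c) <= vol (ellipsoid Y d))%E = (\det Y <= \det X).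
Proof.
move=> pX pY; rewrite !vol_ellipsoid// lee_fin ler_pM2l ?ball_volume_gt0//.
have [X0 Y0] := (posdef_det_gt0 pX, posdef_det_gt0 pY).
by rewrite lef_pV2 ?posrE ?sqrtr_gt0// ler_psqrt ?nnegrE// ltW.
Qed.

Lemma unit_ballE N : @unit_ball R N = ellipsoid 1%:M 0.
Proof.
apply/funext => v; rewrite /unit_ball /ellipsoid /= subr0 mul1mx -enorm_sqr.
by rewrite expr_le1// sqrtr_ge0.
Qed.

(** With [a] and [b] the two points relative to the center, convexity comes
    from [q (l a + (1 - l) b) = l q a + (1 - l) q b - l (1 - l) q (a - b)]. *)
Lemma convex_ellipsoid N (X : 'M[R]_N) c : posdef X ->
  @convex_set R 'cV[R]_N (ellipsoid X c).
Proof.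
move=> pX x y t; rewrite !inE /ellipsoid /= -!/(qform _ _) => qx qy.
pose l : R := t%:num.
have [l0 l1] : 0 <= l /\ l <= 1 by rewrite /l.
have -> : conv t x y - c = l *: (x - c) + (1 - l) *: (y - c).
  have -> : conv t x y = l *: x + (1 - l) *: y by [].
  rewrite !scalerBr addrACA -opprD -scalerDl addrCA subrr addr0 scale1r //.
move: {x y} (x - c) (y - c) qx qy => a b qx qy.
have := posdef_ge0 (a - b) pX.
rewrite !qformD ?pX.1// qformN dotNr !qformZ -scalemxAr dotZl dotZr => h.
move: (qform X a) (qform X b) (dot _ _) qx qy h => A B C qx qy h.
have l2 : 0 <= 1 - l by rewrite subr_ge0.
have h1 := mulr_ge0 (mulr_ge0 l0 l2) h.
have h2 : 0 <= l * (1 - A) by rewrite mulr_ge0// subr_ge0.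
have h3 : 0 <= (1 - l) * (1 - B) by rewrite mulr_ge0// subr_ge0.
rewrite -subr_ge0; set d := (X in 0 <= X).
have -> : d = l * (1 - A) + (1 - l) * (1 - B) + l * (1 - l) * (A + 2 * - C + B).
  by rewrite /d; ring.
by rewrite !addr_ge0.
Qed.

Lemma sym_hull_ellipsoid M N (phi : 'I_M -> 'cV[R]_N) X c : posdef X ->
  sym_hull phi `<=` ellipsoid X c <->
  forall i, ellipsoid X c (phi i) /\ ellipsoid X c (- phi i).
Proof.
move=> pX; split=> [sub i|h].
  by split; apply: sub; apply: sub_gen_smallest; [left|right]; exists i.
apply: smallest_sub; first exact: convex_ellipsoid.
by move=> _ [[i _ <-]|[i _ <-]]; have [] := h i.
Qed.

End EllipsoidVolume.

(** * Farkas' lemma *)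

Section Farkas.
Context {R : realType}.

(** By induction on the number of generators.  If [y] separates [b] from all
    generators but the first one [a0], and [<a0, y> > 0], project everything
    along [a0] onto the hyperplane orthogonal to [y] and apply the induction
    hypothesis there.  A representation of the projection of [b] lifts, and
    the coefficient of [a0] comes out nonnegative because of the signs of [y];
    a separating [z] lifts to the functional [z] composed with the
    projection. *)
Lemma farkas d n (a : 'I_n -> 'cV[R]_d) (b : 'cV[R]_d) :
  (exists w : 'I_n -> R, (forall i, 0 <= w i) /\ b = \sum_i w i *: a i) \/
  (exists y, (forall i, dot (a i) y <= 0) /\ 0 < dot b y).
Proof.
elim: n a b => [|n IH] a b.
  have [->|b0] := eqVneq b 0.
    by left; exists (fun=> 0); split => //; rewrite big_ord0.
  right; exists b; split=> [[]//|].
  rewrite lt_def dot_ge0 andbT; apply: contra_neq b0; exact: dot_eq0.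
pose a' i := a (lift ord0 i).
have [[w [w0 wE]]|[y [ya yb]]] := IH a' b.
  left; exists (fun i => oapp w 0 (unlift ord0 i)).
  split=> [i|]; first by case: unlift.
  rewrite big_ord_recl unlift_none scale0r add0r wE.
  by apply: eq_bigr => i _; rewrite liftK.
have [ya0|ya0] := leP (dot (a ord0) y) 0.
  right; exists y; split=> // i.
  by case: (unliftP ord0 i) => [j ->|->//]; exact: ya.
pose p (v : 'cV[R]_d) := v - (dot v y / dot (a ord0) y) *: a ord0.
have [[w [w0 wE]]|[z [za zb]]] := IH (p \o a') (p b).
  left.
  (* the coefficient that makes the two sides agree against y *)
  pose w1 := (dot b y - \sum_i w i * dot (a' i) y) / dot (a ord0) y.
  exists (fun i => oapp w w1 (unlift ord0 i)); split=> [i|].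
    case: unlift => //=; rewrite divr_ge0 ?(ltW ya0)// subr_ge0.
    rewrite (le_trans _ (ltW yb))// sumr_le0// => j _.
    by rewrite mulr_ge0_le0.
  rewrite big_ord_recl unlift_none /=.
  under eq_bigr do rewrite liftK /= -/(a' _).
  have -> : b = p b + (dot b y / dot (a ord0) y) *: a ord0 by rewrite subrK.
  rewrite wE /w1 mulrBl scalerBl.
  rewrite addrC -addrA; congr (_ + _).
  rewrite [RHS]addrC mulr_suml scaler_suml -sumrB.
  by apply: eq_bigr => i _; rewrite /= /p scalerBr scalerA mulrA.
right.
(* y' represents the functional z \o p, which kills a ord0 *)
pose y' := z - (dot (a ord0) z / dot (a ord0) y) *: y.
have y'E v : dot v y' = dot (p v) z.
  by rewrite dotDr dotNr dotZr dotDl dotNl dotZl; ring.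
exists y'; split=> [i|]; last by rewrite y'E.
rewrite y'E; case: (unliftP ord0 i) => [j ->|->]; first exact: za.
by rewrite /p divff ?gt_eqF// scale1r subrr dotC dotr0.
Qed.

End Farkas.

(** * Perturbations of the identity matrix *)

Section Perturbation.
Context {R : realType}.

Lemma qform_lower_bound N (S : 'M[R]_N) :
  exists2 C, 0 <= C & forall v, - C * dot v v <= qform S v.
Proof.
exists (\sum_i \sum_j `|S i j|) => [|v].
  by apply: sumr_ge0 => i _; apply: sumr_ge0.
rewrite mulNr lerNl /qform /dot -sumrN mulr_suml.
apply: ler_sum => i _; rewrite mxE mulr_suml -sumrN mulr_suml.
apply: ler_sum => j _.
have sq_le k : v k ord0 ^+ 2 <= \sum_i v i ord0 * v i ord0.
  rewrite (bigD1 k)//= -expr2 lerDl sumr_ge0// => l _.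
  by rewrite -expr2 sqr_ge0.
have h : `|v j ord0 * v i ord0| <= \sum_i v i ord0 * v i ord0.
  have := sq_le i; have := sq_le j; rewrite ler_norml => hi hj.
  by apply/andP; split; nra.
rewrite (le_trans (ler_norm _))// normrN -mulrA normrM.
by rewrite ler_wpM2l.
Qed.

(** First order expansion of the determinant, read off the characteristic
    polynomial [p] of [- S]: [det (1 + e S) = e^N p(1/e)], the two leading
    coefficients of [p] are 1 and [tr S], and the remaining terms carry a
    factor [e^2]. *)
Lemma det1D_lower_bound N (S : 'M[R]_N) :
  exists2 C, 0 <= C & forall e, 0 < e <= 1 ->
    1 + e * \tr S - C * e ^+ 2 <= \det (1%:M + e *: S).
Proof.
case: N S => [|n] S.
  exists 0 => // e _.
  by rewrite det_mx00 [S]flatmx0 mxtrace0 mulr0 mul0r addr0 subr0.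
pose p := char_poly (- S).
exists (\sum_(i < n) `|p`_i|) => [|e /andP[e0 e1]]; first exact: sumr_ge0.
have pE x : \det (x%:M + S) = p.[x].
  rewrite -[_.[x]]/(horner_eval x p) /p /char_poly -det_map_mx; congr (\det _).
  apply/matrixP => i j.
  by rewrite !mxE -[RHS]/(horner _ x) !hornerE hornerMn hornerX opprK.
have -> : 1%:M + e *: S = e *: (e^-1%:M + S).
  by rewrite scalerDr scale_scalar_mx mulfV ?gt_eqF.
rewrite detZ pE horner_coef size_char_poly big_ord_recr big_ord_recr /=.
have -> : p`_n.+1 = 1.
  by have /monicP := char_poly_monic (- S); rewrite lead_coefE size_char_poly.
have -> : p`_n = \tr S.
  by rewrite (@char_poly_trace _ n.+1)// raddfN opprK.
rewrite !mulrDr mul1r -exprMn mulfV ?gt_eqF// expr1n.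
have -> : e ^+ n.+1 * (\tr S * e^-1 ^+ n) = e * \tr S.
  by rewrite mulrCA exprS -mulrA -exprMn mulfV ?gt_eqF// expr1n mulr1 mulrC.
rewrite [leRHS]addrC [X in _ <= 1 + X]addrC addrA lerD2l lerNl.
rewrite mulr_sumr -sumrN mulr_suml.
apply: ler_sum => i _.
have -> : e ^+ n.+1 * (p`_i * e^-1 ^+ i) = p`_i * e ^+ (n.+1 - i).
  rewrite mulrCA; congr (_ * _).
  by rewrite exprVn -expfB// (leq_trans (ltn_ord i)).
rewrite (le_trans (ler_norm _))// normrN normrM ler_wpM2l//.
rewrite ger0_norm ?exprn_ge0 ?(ltW e0)//.
rewrite -(subnKC (_ : 2 <= n.+1 - i)%N); last first.
  by rewrite ltn_subRL addn1 ltnS.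
by rewrite exprD ler_piMr ?sqr_ge0// exprn_ile1// ltW.
Qed.

Lemma posdef_perturbation N (S : 'M[R]_N) : S^T = S -> 0 < \tr S ->
  exists e, [/\ 0 < e, posdef (1%:M + e *: S) & 1 < \det (1%:M + e *: S)].
Proof.
move=> sS t0; set t := \tr S in t0.
have [C C0 hC] := qform_lower_bound S.
have [C' C'0 hC'] := det1D_lower_bound S.
(* e is chosen to have e <= 1, e * C < 1 and C' * e < t at the same time. *)
pose d := t * (1 + C) + C' + 1.
have d0 : 0 < d by rewrite /d; nra.
pose e := t / d.
have e0 : 0 < e by rewrite divr_gt0.
have ed : e * d = t by rewrite /e divfK// gt_eqF.
have e1 : e <= 1 by rewrite ler_pdivrMr// mul1r /d; nra.
have eC : e * C < 1 by rewrite mulrAC ltr_pdivrMr// mul1r /d; nra.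
have eC' : C' * e < t.
  by rewrite -ed mulrC ltr_pM2l// /d; nra.
exists e; split => //.
  split=> [|v v0].
    by rewrite linearD linearZ /= trmx1 sS.
  rewrite -/(qform _ v) qformDl qform1 qformZl.
  have vv : 0 < dot v v.
    by rewrite lt_def dot_ge0 andbT; apply: contra_neq v0; exact: dot_eq0.
  have h := hC v.
  have h1 : 0 < dot v v * (1 - e * C) by rewrite mulr_gt0// subr_gt0.
  have h2 := ler_wpM2l (ltW e0) h.
  by move: (dot v v) (qform S v) h1 h2 => x q h1 h2; lra.
apply: lt_le_trans (hC' e _); last by rewrite e0.
have : 0 < e * (t - C' * e) by rewrite mulr_gt0// subr_gt0.
by rewrite -/t; lra.
Qed.
End Perturbation.

(** * Scalable frames and minimal ellipsoids *)

Section Frames.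
Context {R : realType} {M N : nat}.
Implicit Types (phi : 'I_M -> 'cV[R]_N) (w : 'I_M -> R) (X : 'M[R]_N).

Definition frame_op phi w : 'M[R]_N :=
  \sum_i w i *: (phi i *m (phi i)^T).

Lemma mxtrace_frame_op phi w X :
  \tr (X *m frame_op phi w) = \sum_i w i * qform X (phi i).
Proof.
rewrite mulmx_sumr raddf_sum /=; apply: eq_bigr => i _.
by rewrite -scalemxAr mxtraceZ qform_mxtrace.
Qed.

Lemma qform_frame_op phi w x :
  qform (frame_op phi w) x = \sum_i w i * dot x (phi i) ^+ 2.
Proof.
rewrite qform_mxtrace mxtrace_mulC mxtrace_frame_op; apply: eq_bigr => i _.
congr (_ * _); rewrite /qform -mulmxA [x^T *m _]mx11_scalar -dotE.
by rewrite mul_mx_scalar dotZl dotC expr2.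
Qed.

Lemma frame_op_sym phi w : (frame_op phi w)^T = frame_op phi w.
Proof.
rewrite raddf_sum; apply: eq_bigr => i _.
by rewrite /= linearZ /= trmx_mul trmxK.
Qed.

(** The weights are the squares of the scaling factors divided by the tight
    bound; a symmetric matrix is determined by its quadratic form. *)
Lemma scalable_frameP phi : scalable_frame phi <->
  exists w, (forall i, 0 <= w i) /\ frame_op phi w = 1%:M.
Proof.
have coef (s : 'I_M -> R) x :
    \sum_i `|dot x (s i *: phi i)| ^+ 2 = \sum_i s i ^+ 2 * dot x (phi i) ^+ 2.
  by apply: eq_bigr => i _; rewrite dotZr real_normK ?num_real// exprMn.
split=> [[s [s0 [A [A0 [_ sA]]]]]|[w [w0 wE]]].
  exists (fun i => s i ^+ 2 / A); split=> [i|].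
    by rewrite divr_ge0 ?sqr_ge0// ltW.
  apply/eqP; rewrite -subr_eq0; apply/eqP/qform_eq0 => [|x].
    by rewrite linearB /= frame_op_sym trmx1.
  have -> : forall B : 'M[R]_N, qform (B - 1%:M) x = qform B x - dot x x.
    by move=> B; rewrite qformDl -scaleN1r qformZl qform1 mulN1r.
  rewrite qform_frame_op; have [h1 h2] := sA x.
  have /eqP : A * enorm x ^+ 2 == \sum_i `|dot x (s i *: phi i)| ^+ 2.
    by rewrite eq_le h1 h2.
  rewrite coef enorm_sqr => h; apply/eqP; rewrite subr_eq0; apply/eqP.
  apply: (mulfI (_ : A != 0)); first by rewrite gt_eqF.
  rewrite h mulr_sumr; apply: eq_bigr => i _.
  by field; rewrite gt_eqF.
exists (fun i => Num.sqrt (w i)); split=> [i|]; first exact: sqrtr_ge0.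
exists 1; split; [exact: ltr01 | split; [exact: lexx | move=> x]].
rewrite coef mul1r enorm_sqr -qform1 -wE qform_frame_op.
suff -> : \sum_i Num.sqrt (w i) ^+ 2 * dot x (phi i) ^+ 2 =
  \sum_i w i * dot x (phi i) ^+ 2 by split.
by apply: eq_bigr => i _; rewrite sqr_sqrtr.
Qed.

Lemma unit_norm_dot phi i : unit_norm phi -> dot (phi i) (phi i) = 1.
Proof. by move=> u; rewrite -enorm_sqr u expr1n. Qed.

Lemma sum_weights phi w : unit_norm phi -> frame_op phi w = 1%:M ->
  \sum_i w i = N%:R.
Proof.
move=> u wE; have := mxtrace_frame_op phi w 1%:M.
rewrite mul1mx wE mxtrace1 => ->; apply: eq_bigr => i _.
by rewrite qform1 unit_norm_dot// mulr1.
Qed.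

Lemma sym_hull_unit_ball phi : unit_norm phi ->
  sym_hull phi `<=` @unit_ball R N.
Proof.
move=> u; rewrite unit_ballE; apply/(sym_hull_ellipsoid _ _ (posdef1 N)) => i.
by rewrite /ellipsoid /= !subr0 !mul1mx dotNl dotNr opprK unit_norm_dot.
Qed.

(** By the parallelogram law, adding the conditions that [phi i] and
    [- phi i] belong to the ellipsoid gives
    [qform X (phi i) + qform X c <= 1]; the claim is the average of these
    inequalities with weights [w]. *)
Lemma mxtrace_ellipsoid_le phi w X c : unit_norm phi ->
  (forall i, 0 <= w i) -> frame_op phi w = 1%:M ->
  posdef X -> sym_hull phi `<=` ellipsoid X c ->
  \tr X + N%:R * qform X c <= N%:R.
Proof.
move=> u w0 wE pX /(sym_hull_ellipsoid _ _ pX) h.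
have le1 i : qform X (phi i) + qform X c <= 1.
  have [h1 h2] := h i; have := qform_parallelogram (phi i) c pX.1.
  move: h1 h2; rewrite /ellipsoid /= -!/(qform _ _).
  by rewrite -[- phi i - c]opprD qformN; lra.
have := mxtrace_frame_op phi w X; rewrite wE mulmx1 => ->.
rewrite -(sum_weights u wE) mulr_suml -big_split /=.
by apply: ler_sum => i _; rewrite -mulrDr -[leRHS]mulr1 ler_wpM2l.
Qed.

(** [vol_ellipsoid_le] turns minimality into a comparison of determinants, so
    [mxtrace_ellipsoid_le] and [posdef_det_le_expR] show that the ball is
    minimal and [posdef_det_ge1_tr_le] that nothing else is. *)
Lemma scalable_min_ellipsoid phi : unit_norm phi -> scalable_frame phi ->
  is_min_ellipsoid phi (@unit_ball R N) /\
  forall E, is_min_ellipsoid phi E -> E = @unit_ball R N.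
Proof.
move=> u /scalable_frameP[w [w0 wE]]; have p1 := @posdef1 R N.
have ballP : is_ellipsoid (@unit_ball R N).
  by exists 1%:M, 0; split=> //; exact: unit_ballE.
split=> [|E [[X [c [pX ->]]] sub min]].
  split=> //; first exact: sym_hull_unit_ball.
  move=> _ [X [c [pX ->]]] sub; rewrite unit_ballE vol_ellipsoid_le// det1.
  apply: le_trans (posdef_det_le_expR pX) _.
  rewrite -[leRHS]expR0 ler_expR subr_le0.
  apply: le_trans _ (mxtrace_ellipsoid_le u w0 wE pX sub).
  by rewrite lerDl mulr_ge0// posdef_ge0.
have := min _ ballP (sym_hull_unit_ball u).
rewrite unit_ballE vol_ellipsoid_le// det1 => det_ge1.
have tr_le := mxtrace_ellipsoid_le u w0 wE pX sub.
have X1 : X = 1%:M.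
  apply: posdef_det_ge1_tr_le => //; apply: le_trans _ tr_le.
  by rewrite lerDl mulr_ge0// posdef_ge0.
suff -> : c = 0 by rewrite X1.
apply: dot_eq0; apply/eqP; rewrite eq_le dot_ge0 andbT.
move: tr_le; rewrite X1 mxtrace1 gerDl qform1.
(* for N = 0 the trace bound says nothing, but then c has no coordinates *)
case: (posnP N) => [N0 _|N0]; last by rewrite pmulr_rle0// ltr0n.
by rewrite /dot big1// => i; have := ltn_ord i; rewrite [X in (_ < X)%N]N0.
Qed.

Lemma dot_mxvec (A B : 'M[R]_N) :
  dot (mxvec A)^T (mxvec B)^T = \tr (A^T *m B).
Proof.
rewrite /dot (reindex _ (curry_mxvec_bij _ _)) /=.
transitivity (\sum_p A p.1 p.2 * B p.1 p.2).
  by apply: eq_bigr => -[i j] _ /=; rewrite ![_^T _ _]mxE !mxvecE.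
rewrite -(pair_bigA _ (fun i j => A i j * B i j)) exchange_big /=.
by apply: eq_bigr => j _; rewrite mxE; apply: eq_bigr => i _; rewrite mxE.
Qed.

(** Farkas' lemma in the space of matrices: a separating [H] is made symmetric
    by adding its transpose, which only doubles its pairings with symmetric
    matrices. *)
Lemma frame_op_alternative phi :
  (exists w, (forall i, 0 <= w i) /\ frame_op phi w = 1%:M) \/
  (exists S : 'M[R]_N,
    [/\ S^T = S, 0 < \tr S & forall i, qform S (phi i) <= 0]).
Proof.
have [[w [w0 wE]]|[y [ya yb]]] :=
  farkas (fun i => (mxvec (phi i *m (phi i)^T))^T) (mxvec (1%:M : 'M[R]_N))^T.
  left; exists w; split=> //; apply: (can_inj mxvecK); apply: trmx_inj.
  rewrite wE /frame_op !linear_sum /=.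
  by apply: eq_bigr => i _; rewrite !linearZ.
right; pose H := vec_mx y^T : 'M[R]_N.
have yE : y = (mxvec H)^T by rewrite vec_mxK trmxK.
exists (H + H^T); split=> [||i].
- by rewrite linearD /= trmxK addrC.
- rewrite mxtraceD mxtrace_tr; move: yb.
  by rewrite yE dot_mxvec trmx1 mul1mx => ?; rewrite addr_gt0.
- rewrite qformDl qform_tr; have := ya i.
  rewrite yE dot_mxvec trmx_mul trmxK mxtrace_mulC -qform_mxtrace => h.
  by rewrite -oppr_ge0 opprD addr_ge0// oppr_ge0.
Qed.

(** Otherwise the ellipsoid of [1 + e S], with [S] a separating matrix, would
    contain the symmetric hull and have a smaller volume than the ball. *)
Lemma min_ellipsoid_scalable phi : unit_norm phi ->
  is_min_ellipsoid phi (@unit_ball R N) -> scalable_frame phi.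
Proof.
move=> u [_ _ min]; apply/scalable_frameP.
have [//|[S [sS trS Sphi]]] := frame_op_alternative phi.
have [e [e0 pX det_gt1]] := posdef_perturbation sS trS.
set X := 1%:M + e *: S in pX det_gt1.
have sub : sym_hull phi `<=` ellipsoid X 0.
  apply/(sym_hull_ellipsoid _ _ pX) => i.
  rewrite /ellipsoid /= -!/(qform _ _) !subr0 qformN qformDl qformZl qform1.
  by rewrite unit_norm_dot// gerDl mulr_ge0_le0// ltW.
have : is_ellipsoid (ellipsoid X 0) by exists X, 0.
move=> /min /(_ sub); rewrite unit_ballE vol_ellipsoid_le ?det1//.
  by rewrite leNgt det_gt1.
exact: posdef1.
Qed.

End Frames.

Theorem theorem2p11 (R : realType) (M N : nat) (phi : 'I_M -> 'cV[R]_N)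
  (hframe : is_frame phi) (hunit : unit_norm phi) :
  (scalable_frame phi <-> min_ellipsoid phi = @unit_ball R N) /\
  (min_ellipsoid phi = @unit_ball R N -> rel_vol phi = 1%R).
Proof.
split; last first.
  move=> E; rewrite /rel_vol E divff// unit_ballE.
  rewrite vol_ellipsoid; last exact: posdef1.
  by rewrite det1 sqrtr1 divr1 /= gt_eqF// ball_volume_gt0.
split=> [/(scalable_min_ellipsoid hunit)[minB uniq]|E].
  exact: xget_unique.
apply: min_ellipsoid_scalable => //; move: E; rewrite /min_ellipsoid.
(* min_ellipsoid is not the default value set0, because the ball contains 0 *)
case: xgetP => [B _ minB <-//|_ /seteqP[_ /(_ 0)]].
by rewrite unit_ballE /ellipsoid /= subr0 mulmx0 dotr0 => /(_ ler01).
Qed.
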